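(* For every $n\ge1$, the number of loopless and coloopless Schubert delta matroids on $[n]$ is equal to the number of signed derangements of $[\pm n]$.
   Context: $[n]=\{1,\dots,n\}$, $[\pm n]=\{\pm1,\dots,\pm n\}$. $S_n^B$ is the group of signed permutations: bijections $w:[\pm n]\to[\pm n]$ with $w(-i)=-w(i)$. A signed derangement is $\pi\in S_n^B$ with $\pi(i)\ne i$ for all $i\in[\pm n]$. A delta matroid on $[n]$ is a nonempty collection $\mathcal F$ of subsets of $[n]$ (feasible sets) such that for $A_1,A_2\in\mathcal F$ and $e\in A_1\triangle A_2$ there is $f\in A_1\triangle A_2$ with $A_1\triangle\{e,f\}\in\mathcal F$; its feasible polytope is $\operatorname{FP}=\operatorname{conv}(e_A:A\in\mathcal F)\subset\mathbb R^n$, $e_A=\sum_{i\in A}e_i$. It is loopless if every $i\in[n]$ is in some feasible set and coloopless if no $i\in[n]$ is in every feasible set. For $A=\{a_1<\dots<a_j\}$, $B=\{b_1<\dots<b_k\}$ subsets of $[n]$ put $A\preceq B$ iff $j\le k$ and $a_{j-i}\le b_{k-i}$ for $0\le i\le j-1$. For $S\subseteq[n]$ the standard Schubert delta matroid $\Delta_S$ has feasible sets $\{T\subseteq[n]:T\preceq S\}$. $S_n^B$ acts on $\mathbb R^n$ by $we_i=e_{w(i)}$ with $e_{-j}:=-e_j$. The Schubert delta matroid $\Delta_S^w$ is the delta matroid with feasible polytope $w\cdot\operatorname{FP}(\Delta_S)+e_T$, where $T=\{|w(i)|:i\in[n],w(i)<0\}$. Schubert delta matroids are all the $\Delta_S^w$,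 counted as delta matroids (different pairs $(w,S)$ may coincide). *)

(* Defs.v *)
From HB Require Import structures.
From mathcomp Require Import all_boot all_order all_algebra perm.
From mathcomp Require Import boolp classical_sets reals convex.

Set Implicit Arguments.
Unset Strict Implicit.
Unset Printing Implicit Defensive.

Import Order.TTheory GRing.Theory Num.Theory.

Local Open Scope ring_scope.

(* The ground set {1, ..., n} is represented by 'I_n = {0, ..., n-1}; the shift
   by one preserves the order. *)

(* The set {+-1, ..., +-n}: (i, false) is +i and (i, true) is -i. *)
Definition signed (n : nat) : finType := ('I_n * bool)%type.

Definition pos (n : nat) (i : 'I_n) : signed n := (i, false).

Definition neg (n : nat) (x : signed n) : signed n := (x.1, ~~ x.2).

Definition signed_perm (n : nat) (w : {perm signed n}) : bool :=
  [forall x, w (neg x) == neg (w x)].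

Definition signed_derangement (n : nat) (w : {perm signed n}) : bool :=
  signed_perm w && [forall x, w x != x].

Definition symdiff (n : nat) (A B : {set 'I_n}) : {set 'I_n} :=
  ((A :\: B) :|: (B :\: A))%SET.

Definition delta_matroid (n : nat) (F : {set {set 'I_n}}) : bool :=
  (F != finset.set0) &&
  [forall A1 in F, forall A2 in F, forall e in symdiff A1 A2,
     exists f in symdiff A1 A2, symdiff A1 [set e; f]%SET \in F].

Definition loopless (n : nat) (F : {set {set 'I_n}}) : bool :=
  [forall i, exists A in F, i \in A].

Definition coloopless (n : nat) (F : {set {set 'I_n}}) : bool :=
  [forall i, ~~ [forall A in F, i \in A]].

Definition indicator_vec (R : realType) (n : nat) (A : {set 'I_n}) :
    'rV[R]_n :=
  \sum_(i in A) delta_mx 0 i.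

Definition convex_hull (R : realType) (n : nat) (X : set 'rV[R]_n) :
    set 'rV[R]_n :=
  smallest (@convex_set R 'rV[R]_n) X.

Definition feasible_polytope (R : realType) (n : nat) (F : {set {set 'I_n}}) :
    set 'rV[R]_n :=
  convex_hull [set indicator_vec R A | A in [set` F]]%classic.
Arguments feasible_polytope R {n} F.

(* [enum] lists a set of ordinals in increasing order. *)
Definition elements (n : nat) (A : {set 'I_n}) : seq nat :=
  [seq val i | i <- enum A].

(* With 0-based lists, the (j - i)-th smallest element is the item j - i.+1. *)
Definition gale_le (n : nat) (A B : {set 'I_n}) : bool :=
  ((#|A| <= #|B|) &&
   [forall i : 'I_#|A|,
      nth 0 (elements A) (#|A| - i.+1) <= nth 0 (elements B) (#|B| - i.+1)])%N.

Definition standard_schubert (n : nat) (S : {set 'I_n}) : {set {set 'I_n}} :=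
  [set T : {set 'I_n} | gale_le T S]%SET.

(* e_j, with e_{-j} = - e_j. *)
Definition signed_basis_vec (R : realType) (n : nat) (x : signed n) :
    'rV[R]_n :=
  (-1) ^+ x.2 *: delta_mx 0 x.1.

Definition signed_perm_act (R : realType) (n : nat) (w : {perm signed n})
    (v : 'rV[R]_n) : 'rV[R]_n :=
  \sum_(i < n) v 0 i *: signed_basis_vec R (w (pos i)).

Definition negative_values (n : nat) (w : {perm signed n}) : {set 'I_n} :=
  [set (w (pos i)).1 | i : 'I_n & (w (pos i)).2]%SET.

(* F is the Schubert delta matroid of the pair (w, S). *)
Definition is_schubert_of (R : realType) (n : nat) (w : {perm signed n})
    (S : {set 'I_n}) (F : {set {set 'I_n}}) : Prop :=
  delta_matroid F /\
  feasible_polytope R F =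
    [set signed_perm_act w v + indicator_vec R (negative_values w)
       | v in feasible_polytope R (standard_schubert S)]%classic.

Definition is_schubert (R : realType) (n : nat) (F : {set {set 'I_n}}) : Prop :=
  exists (w : {perm signed n}) (S : {set 'I_n}),
    signed_perm w /\ is_schubert_of R w S F.

(* Main.v *)
(* A family of the form w . Delta_S is cut out by the inequalities "the number
   of twisted letters met among the k topmost ones is at most the number of bits
   of S met there".  When there is neither a loop nor a coloop the bits read
   1^a1 0^b1 1^a2 0^b2 ... from the top, and the family is determined by, and
   determines, the blocks G_i (of size a_i + b_i), the numbers 0 < a_i < |G_i|
   and the set of letters of the blocks that are negated; the letters below the
   last bit 0 are unconstrained and their signs are irrelevant.  With c = |G_i|,
   these data have exponential generating function
     e^x / (1 - sum_c (c - 1) (2x)^c / c!) = e^(-x) / (1 - 2x),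
   that of signed derangements.  Both counts are compared through their sums
   over the subsets of a set A, which are equal to 2^|A| |A|!. *)
Require Import Defs.
From mathcomp Require Import all_boot all_order all_algebra perm.
From mathcomp Require Import fingroup action.
From mathcomp Require Import zify.

Set Implicit Arguments.
Unset Strict Implicit.
Unset Printing Implicit Defensive.

Local Open Scope nat_scope.
Local Open Scope set_scope.

(** * Codes, the families they cut out, and their uniqueness *)

Section Codes.

Variable T : finType.
Implicit Types (A B G Z Y : {set T}) (b : seq ({set T} * nat)) (r : nat).

(* A code lists the pairs [(G_i, a_i)] of the header, topmost block first; [r] is
   the slack left over by the blocks already read. *)
Fixpoint feasB r b Z : bool :=
  if b is (G, a) :: b' then
    (#|Z :&: G| <= r + a) && feasB (r + a - #|Z :&: G|) b' Z
  else true.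

Fixpoint supp b : {set T} := if b is (G, _) :: b' then G :|: supp b' else set0.

(** Shrinking [A] keeps the blocks pairwise disjoint. The strict bounds put both bits in every
    block; uniqueness of codes rests on this. *)
Fixpoint valid A b : bool :=
  if b is (G, a) :: b' then
    [&& G \subset A, 0 < a < #|G| & valid (A :\: G) b']
  else true.

Lemma valid_supp A b : valid A b -> supp b \subset A.
Proof.
elim: b A => [|[G a] b IH] A /=; first by rewrite sub0set.
case/and3P=> sGA _ /IH sb; rewrite subUset sGA /=.
exact: subset_trans sb (subsetDl _ _).
Qed.

Lemma valid_disjoint A G b : valid (A :\: G) b -> [disjoint G & supp b].
Proof.
move=> /valid_supp sb; rewrite disjoint_sym disjoints_subset.
by apply: subset_trans sb _; rewrite setDE subsetIr.
Qed.

Lemma feasB_eq r b Z Y : Z :&: supp b = Y :&: supp b -> feasB r b Z = feasB r b Y.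
Proof.
move/setP=> e; elim: b r e => [|[G a] b IH] r //= e.
have -> : Z :&: G = Y :&: G.
  by apply/setP=> x; move: (e x); rewrite !inE; case: (x \in G); rewrite ?andbF ?andbT.
rewrite (IH (r + a - _)) // => x; move: (e x).
by rewrite !inE; case: (x \in supp b); rewrite ?orbT ?andbF ?andbT.
Qed.

Lemma feasB_mono r r' b Z Z' :
  r <= r' -> Z' \subset Z -> feasB r b Z -> feasB r' b Z'.
Proof.
elim: b r r' => [|[G a] b IH] r r' //= le_r sZ /andP[h1 h2].
have le_c : #|Z' :&: G| <= #|Z :&: G| by apply/subset_leq_card/setSI.
by apply/andP; split; [lia | apply: IH h2 => //; lia].
Qed.

Lemma feasB_set1 A r b j : valid A b -> feasB r b [set j].
Proof.
elim: b A r => [|[G a] b IH] A r //= /and3P[_ /andP[a0 _] /IH]; rewrite {}/IH => IH.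
rewrite IH andbT; apply: leq_trans (subset_leq_card (subsetIl _ _)) _.
by rewrite cards1 ltn_addl.
Qed.

Lemma feasB0 A r b : valid A b -> feasB r b set0.
Proof.
elim: b r A => [|[G a] b IH] r A //= /and3P[_ _ /IH]; rewrite set0I cards0 => -> //.
Qed.

(** The extra unit of slack travels down to the block containing [j], if there is one, and is spent
    there. *)
Lemma feasB_add A r b Z j : valid A b -> feasB r b Z -> feasB r.+1 b (j |: Z).
Proof.
elim: b A r => [|[G a] b IH] A r //= /and3P[_ _ vb] /andP[h1 h2].
have dGb := valid_disjoint vb.
have [jG|jG] := boolP (j \in G).
  have le_c : #|(j |: Z) :&: G| <= #|Z :&: G|.+1.
    have : #|j |: Z :&: G| <= #|Z :&: G|.+1 by rewrite cardsU1; case: (_ \notin _).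
    by apply: leq_trans; apply/subset_leq_card; rewrite setIUl setSU ?subsetIl.
  apply/andP; split; first by lia.
  have e : (j |: Z) :&: supp b = Z :&: supp b.
    apply/setP=> x; rewrite !inE; case: eqP => //= ->.
    by rewrite (disjointFr dGb jG) andbF.
  by rewrite (feasB_eq _ e); apply: feasB_mono h2 => //; lia.
have -> : (j |: Z) :&: G = Z :&: G.
  by apply/setP=> x; rewrite !inE; case: eqP => //= ->; rewrite (negPf jG) andbF.
rewrite addSn (leq_trans h1) //= subSn //; exact: IH vb h2.
Qed.

Lemma subset_card G m : m <= #|G| -> exists2 Y : {set T}, Y \subset G & #|Y| = m.
Proof.
move=> le_m; have : 0 < #|[set Y : {set T} | Y \subset G & #|Y| == m]|.
  by rewrite cards_draws bin_gt0.
by case/card_gt0P=> Y; rewrite inE => /andP[sY /eqP cY]; exists Y.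
Qed.

(** The filling of the top block tunes the slack passed on: with [#|Y| = a] the tail is tested with
    slack 0, like a code of its own. *)
Lemma feasB_head G a b Y : Y \subset G -> #|Y| <= a ->
  [disjoint G & supp b] ->
  forall Z, [disjoint G & Z] -> feasB 0 ((G, a) :: b) (Y :|: Z) = feasB (a - #|Y|) b Z.
Proof.
move=> sYG cY dGb Z dGZ /=.
have -> : (Y :|: Z) :&: G = Y.
  rewrite setIUl (setIidPl sYG) [Z :&: G]setIC.
  by move: dGZ; rewrite -setI_eq0 => /eqP->; rewrite setU0.
rewrite add0n cY /=; apply: feasB_eq; apply/setP=> x; rewrite !inE.
case xY: (x \in Y) => //=; rewrite (disjointFr dGb) ?andbF //.
exact: (subsetP sYG).
Qed.

(** Saturate the blocks above that of [i] and put [a] other letters into its own block: then [i] no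
    longer fits. *)
Lemma feasB_nonfree A b i : valid A b -> i \in supp b ->
  exists2 Z : {set T}, feasB 0 b Z & ~~ feasB 0 b (i |: Z).
Proof.
elim: b A => [|[G a] b IH] A; first by rewrite inE.
case/and3P=> _ /andP[a0 aG] vb; have dGb := valid_disjoint vb.
have [iG _|niG] := boolP (i \in G).
  have [Y sY cY] : exists2 Y : {set T}, Y \subset G :\ i & #|Y| = a.
    by apply: subset_card; have := cardsD1 i G; rewrite iG; lia.
  have sYG := subset_trans sY (subD1set _ _).
  have niY : i \notin Y by apply/negP => /(subsetP sY); rewrite !inE eqxx.
  exists Y.
    rewrite -(setU0 Y) feasB_head ?cY ?(feasB0 _ vb) //.
    by rewrite disjoint_sym disjoints_subset sub0set.
  rewrite /= (setIidPl _) ?subUset ?sub1set ?iG //= cardsU1 niY cY.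
  by rewrite (_ : _ <= _ = false) //; lia.
rewrite [supp _]/(G :|: supp b) in_setU (negPf niG) orFb => /(IH _ vb)[Z fZ nfZ].
have [Y sYG cY] := subset_card (ltnW aG).
have eZ V : feasB 0 ((G, a) :: b) (Y :|: (V :\: G)) = feasB 0 b V.
  rewrite feasB_head ?cY ?leqnn //; last first.
    by rewrite disjoint_sym disjoints_subset setDE subsetIr.
  rewrite subnn; apply: feasB_eq; apply/setP=> x; rewrite !inE.
  by case xb: (x \in supp b); rewrite ?andbF // (disjointFl dGb).
exists (Y :|: (Z :\: G)); first by rewrite eZ.
have -> : i |: (Y :|: Z :\: G) = Y :|: ((i |: Z) :\: G).
  by apply/setP=> x; rewrite !inE; case: eqP => [->|_]; rewrite ?niG ?orbT.
by rewrite eZ.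
Qed.

Section Uniqueness.

Variables (A G : {set T}) (a : nat) (b : seq ({set T} * nat)).
Hypothesis vb : valid A ((G, a) :: b).
Let F := feasB 0 ((G, a) :: b).

Lemma feasB_head_le Z : F Z -> #|Z :&: G| <= a.
Proof. by case/andP. Qed.

Lemma feasB_head_sub Y : Y \subset G -> #|Y| <= a -> F Y.
Proof.
case/and3P: vb => _ _ vb' sY cY; rewrite /F -(setU0 Y) feasB_head //.
- exact: feasB0 vb'.
- exact: valid_disjoint vb'.
- by rewrite disjoint_sym disjoints_subset sub0set.
Qed.

Lemma feasB_head_sub1 Y j : Y \subset G -> #|Y| <= a -> j \notin G -> F (j |: Y).
Proof.
case/and3P: vb => _ _ vb' sY cY jG; rewrite /F setUC feasB_head //.
- exact: feasB_set1 vb'.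
- exact: valid_disjoint vb'.
- by rewrite disjoint_sym disjoints1.
Qed.

(** The trade saves one unit in the top block; this unit is passed on and pays for [j] by
    [feasB_add]. *)
Lemma feasB_head_swap Y i j : i \in G -> j \notin G -> i \notin Y ->
  F (i |: Y) -> F (j |: Y).
Proof.
case/and3P: vb => _ _ vb' iG jG iY; rewrite /F /= => /andP[].
have dGb := valid_disjoint vb'.
have -> : (i |: Y) :&: G = i |: (Y :&: G).
  by apply/setP=> x; rewrite !inE; case: eqP => //= ->.
have -> : (j |: Y) :&: G = Y :&: G.
  by apply/setP=> x; rewrite !inE; case: eqP => //= ->; rewrite (negPf jG) andbF.
rewrite cardsU1 inE (negPf iY) /= !add0n add1n => c1 f1; rewrite ltnW //=.
rewrite -subSS subSn //; apply: feasB_add vb' _.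
rewrite -(@feasB_eq _ _ (i |: Y)) //; apply/setP=> x; rewrite !inE.
by case: eqP => //= ->; rewrite (disjointFr dGb iG) andbF.
Qed.

End Uniqueness.

(** If some [j] of [G2] lay outside [G1], then [a2] letters of [G1] together with [j] would pass the
    first test and overfill [G2]. *)
Lemma feasB_head_nested A1 A2 G1 a1 b1 G2 a2 b2 :
  valid A1 ((G1, a1) :: b1) -> valid A2 ((G2, a2) :: b2) ->
  feasB 0 ((G1, a1) :: b1) =1 feasB 0 ((G2, a2) :: b2) -> G1 \subset G2 -> G1 = G2.
Proof.
move=> v1 v2 e sG; apply/eqP; rewrite eqEsubset sG /=; apply/subsetP=> j jG2.
apply/negPn/negP=> jG1.
have /and3P[_ /andP[_ c1] _] := v1.
(* Nothing yet bounds [a2] by [#|G1|], whence the [minn]; as [a1 < #|G1|], the minimum can only be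
   [a2]. *)
have le21 : a2 <= a1.
  have [Y sY cY] : exists2 Y : {set T}, Y \subset G1 & #|Y| = minn a2 #|G1|.
    by apply: subset_card; rewrite geq_minr.
  have : feasB 0 ((G2, a2) :: b2) Y.
    by apply: (feasB_head_sub v2); rewrite ?cY ?geq_minl ?(subset_trans sY).
  rewrite -e => /feasB_head_le; rewrite (setIidPl sY) cY; lia.
have [Y sY cY] : exists2 Y : {set T}, Y \subset G1 & #|Y| = a2 by apply: subset_card; lia.
have := feasB_head_sub1 v1 sY (leq_trans (eq_leq cY) le21) jG1.
rewrite e => /feasB_head_le; rewrite (setIidPl _) ?subUset ?sub1set ?jG2 ?(subset_trans sY) //.
by rewrite cardsU1 cY (contra (subsetP sY j)) //; lia.
Qed.

(* If neither of [G1], [G2] contained the other, filling [G1 :\ j], adding an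
   [i] of [G2 :\: G1] and trading it for [j] would overfill [G1]. *)
Lemma feasB_head_inj A1 A2 G1 a1 b1 G2 a2 b2 :
  valid A1 ((G1, a1) :: b1) -> valid A2 ((G2, a2) :: b2) ->
  feasB 0 ((G1, a1) :: b1) =1 feasB 0 ((G2, a2) :: b2) -> G1 = G2.
Proof.
move=> v1 v2 e.
have [s12|] := boolP (G1 \subset G2); first exact: feasB_head_nested v1 v2 e s12.
have [s21 _|] := boolP (G2 \subset G1).
  by apply/esym; apply: feasB_head_nested v2 v1 _ s21 => Z; rewrite e.
case/subsetPn=> i iG2 iG1 /subsetPn[j jG1 jG2].
have /and3P[_ /andP[_ c1] _] := v1.
have [Y sY cY] : exists2 Y : {set T}, Y \subset G1 :\ j & #|Y| = a1.
  by apply: subset_card; have := cardsD1 j G1; rewrite jG1; lia.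
have sYG := subset_trans sY (subD1set _ _).
have jY : j \notin Y by apply/negP => /(subsetP sY); rewrite !inE eqxx.
have iY : i \notin Y by apply: contra iG1; apply: (subsetP sYG).
have := feasB_head_sub1 v1 sYG (eq_leq cY) iG1; rewrite e.
move=> /(feasB_head_swap v2 iG2 jG2 iY); rewrite -e => /feasB_head_le.
by rewrite (setIidPl _) ?subUset ?sub1set ?jG1 // cardsU1 jY cY; lia.
Qed.

(** The top set comes from [feasB_head_inj], its [a] is the largest number of its letters in a
    feasible set, and the tail is read off after saturating the top block. *)
Lemma feasB_inj A b1 b2 :
  valid A b1 -> valid A b2 -> feasB 0 b1 =1 feasB 0 b2 -> b1 = b2.
Proof.
(* The empty code accepts every set, whereas a nonempty one rejects its own top block. *)
have nil_cons A' G a b : valid A' ((G, a) :: b) -> feasB 0 ((G, a) :: b) G = false.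
  by case/and3P=> _ /andP[_ c] _ /=; rewrite setIid leqNgt c.
elim: b1 A b2 => [|[G1 a1] b1 IH] A [|[G2 a2] b2] // v1 v2 e.
- by have := e G2; rewrite (nil_cons _ _ _ _ v2).
- by have := e G1; rewrite (nil_cons _ _ _ _ v1).
have eG := feasB_head_inj v1 v2 e; rewrite -{G2}eG in v2 e *.
have le_a b b' a a' : valid A ((G1, a) :: b) -> valid A ((G1, a') :: b') ->
    feasB 0 ((G1, a) :: b) =1 feasB 0 ((G1, a') :: b') -> a <= a'.
  move=> v v' e'; have /and3P[_ /andP[_ /ltnW/subset_card[Y sY cY]] _] := v.
  have := feasB_head_sub v sY (eq_leq cY); rewrite e' => /feasB_head_le.
  by rewrite (setIidPl sY) cY.
have ea : a1 = a2.
  by apply/eqP; rewrite eqn_leq (le_a _ _ _ _ v1 v2) // (le_a _ _ _ _ v2 v1).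
rewrite -{a2 le_a}ea in v2 e *.
have /and3P[_ /andP[_ c1] vb1] := v1; have /and3P[_ _ vb2] := v2.
congr (_ :: _); apply: (IH (A :\: G1)) => // Z.
have [Y sY cY] := subset_card (ltnW c1).
have tail b : valid (A :\: G1) b -> feasB 0 b Z = feasB 0 ((G1, a1) :: b) (Y :|: (Z :\: G1)).
  move=> vb; have dGb := valid_disjoint vb.
  rewrite feasB_head ?cY ?subnn //; last by rewrite disjoint_sym disjoints_subset setDE subsetIr.
  apply: feasB_eq; apply/setP=> x; rewrite !inE.
  by case xb: (x \in supp b); rewrite ?andbF // (disjointFl dGb).
by rewrite !tail.
Qed.

End Codes.

(** * Codes with negated letters *)

Section SignedCodes.

Variable n : nat.
Implicit Types (A X Y Z N : {set 'I_n}) (b : seq ({set 'I_n} * nat)).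

Lemma in_symdiff X Y i : (i \in symdiff X Y) = (i \in X) (+) (i \in Y).
Proof. by rewrite !inE; case: (i \in X); case: (i \in Y). Qed.

Lemma symdiffK Y : involutive (fun X => symdiff X Y).
Proof. by move=> X; apply/setP=> i; rewrite !in_symdiff addbK. Qed.

Definition code_family N b : {set {set 'I_n}} :=
  [set X : {set 'I_n} | feasB 0 b (symdiff X N)].

(** At a constrained letter [i], dropping [i] before the twist keeps feasibility while adding it may
    destroy it. The twisted family is therefore monotone in [i] in one direction only, and this
    direction tells whether [i] is negated. *)
Lemma code_family_sub A N1 b1 N2 b2 :
  valid A b1 -> valid A b2 -> N1 \subset supp b1 ->
  code_family N1 b1 = code_family N2 b2 -> N1 \subset N2.
Proof.
move=> v1 v2 s1 /setP e; apply/subsetP=> i iN1; apply/negPn/negP=> iN2.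
have [Z fZ nfZ] := feasB_nonfree v1 (subsetP s1 i iN1).
have niZ : i \notin Z by apply: contra nfZ => iZ; rewrite (setUidPr _) ?sub1set.
have := e (symdiff Z N1); rewrite !inE symdiffK fZ => /esym f2.
have := e (symdiff (i |: Z) N1); rewrite !inE symdiffK (negPf nfZ) => /esym/negP[].
apply: feasB_mono f2 => //; apply/subsetP=> j; rewrite !in_symdiff !inE.
by case: eqP => // ->; rewrite iN1 (negPf iN2) (negPf niZ).
Qed.

Lemma code_family_inj A N1 b1 N2 b2 :
  valid A b1 -> valid A b2 -> N1 \subset supp b1 -> N2 \subset supp b2 ->
  code_family N1 b1 = code_family N2 b2 -> (N1, b1) = (N2, b2).
Proof.
move=> v1 v2 s1 s2 e.
have eN : N1 = N2.
  by apply/eqP; rewrite eqEsubset (code_family_sub v1 v2 s1 e) (code_family_sub v2 v1 s2 (esym e)).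
rewrite {}eN {s1} in e *; congr (_, _); apply: feasB_inj v1 v2 _ => Z.
by move/setP/(_ (symdiff Z N2)): e; rewrite !inE symdiffK.
Qed.

(** Signs outside the support are invisible; trimming them gives the normal form required by
    [code_family_inj]. *)
Lemma code_family_supp N b : code_family (N :&: supp b) b = code_family N b.
Proof.
apply/setP=> X; rewrite !inE; apply: feasB_eq; apply/setP=> i.
by rewrite in_setI in_symdiff !in_setI in_symdiff andb_addl andb_addl -andbA andbb.
Qed.

(** Before the twist the empty set and all singletons are feasible, so one of them puts [i] into the
    twisted set; the other one serves to exclude coloops below. *)
Lemma code_family_loopless A N b : valid A b -> loopless (code_family N b).
Proof.
move=> vb; apply/forallP=> i; apply/existsP; pose Z := if i \in N then set0 else [set i].
exists (symdiff Z N); rewrite inE symdiffK in_symdiff /Z.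
by case: ifP => iN; rewrite ?(feasB0 _ vb) ?(feasB_set1 _ _ vb) ?iN !inE ?eqxx.
Qed.

Lemma code_family_coloopless A N b : valid A b -> coloopless (code_family N b).
Proof.
move=> vb; apply/forallP=> i; rewrite negb_forall; apply/existsP.
pose Z := if i \in N then [set i] else set0.
exists (symdiff Z N); rewrite inE symdiffK in_symdiff /Z.
by case: ifP => iN; rewrite ?(feasB0 _ vb) ?(feasB_set1 _ _ vb) ?iN !inE ?eqxx.
Qed.

End SignedCodes.

(** * Words of letters with bits, and their compression into codes *)

Section Words.

Variable T : finType.
Implicit Types (A G Z : {set T}) (b : seq ({set T} * nat)) (u v : seq (T * bool)).

(* The letters come from the largest position down, each with the bit telling
   whether its position is in [S]; [r] is the slack. *)
Fixpoint feasW r u Z : bool :=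
  if u is (i, c) :: u' then ((i \in Z) <= r + c) && feasW (r + c - (i \in Z)) u' Z
  else true.

Lemma feasW_ones r s v Z :
  feasW r ([seq (i, true) | i <- s] ++ v) Z = feasW (r + size s - count (mem Z) s) v Z.
Proof.
elim: s r => [|i s IH] r /=; first by rewrite addn0 subn0.
have c1 : (i \in Z) <= r + 1 by case: (_ \in _); lia.
have cs := count_size (mem Z) s.
by rewrite c1 IH; congr (feasW _ _ _); lia.
Qed.

Lemma feasW_zeros r s v Z :
  feasW r ([seq (i, false) | i <- s] ++ v) Z =
  (count (mem Z) s <= r) && feasW (r - count (mem Z) s) v Z.
Proof.
elim: s r => [|i s IH] r /=; first by rewrite subn0.
rewrite addn0 IH andbA subnDA; congr (_ && _).
by case: (i \in Z); lia.
Qed.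

(** Along the ones the test cannot fail, and along the zeros the slack never grows, so only the
    inequality at the end of the block matters. *)
Lemma feasW_block r s1 s2 v Z :
  feasW r ([seq (i, true) | i <- s1] ++ [seq (i, false) | i <- s2] ++ v) Z =
  (count (mem Z) (s1 ++ s2) <= r + size s1) &&
    feasW (r + size s1 - count (mem Z) (s1 ++ s2)) v Z.
Proof.
rewrite feasW_ones feasW_zeros count_cat subnDA; congr (_ && _).
by have := count_size (mem Z) s1; lia.
Qed.

(** [s] is the maximal initial run of the bit [c]; the default of [head] lets an empty remainder
    count as beginning with the other bit. *)
Lemma word_split (c : bool) u : exists s v,
  u = [seq (i, c) | i <- s] ++ v /\ head (~~ c) (unzip2 v) = ~~ c.
Proof.
elim: u => [|[i c'] u [s [v [-> hv]]]]; first by exists [::], [::].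
have [->|ne] := eqVneq c' c; first by exists (i :: s), v.
by exists [::], ((i, c') :: [seq (i, c) | i <- s] ++ v); split=> //; case: c c' ne {hv} => [] [].
Qed.

Lemma count_mem_set s Z : uniq s -> count (mem Z) s = #|Z :&: [set x in s]|.
Proof.
move=> us; rewrite -size_filter -(card_uniqP (filter_uniq _ us)).
by apply: eq_card => x; rewrite !inE mem_filter.
Qed.

(** Each maximal run of ones is joined with the run of zeros after it into a block. The condition on
    the first bit gives the first block a one; a final run of ones constrains nothing. *)
Lemma word_code u : uniq (unzip1 u) -> head true (unzip2 u) ->
  exists2 b, valid [set x in unzip1 u] b & forall r Z, feasW r u Z = feasB r b Z.
Proof.
move: {2}(size u) (leqnn (size u)) => k; elim: k u => [|k IH] u.
  by rewrite leqn0 size_eq0 => /eqP-> _ _; exists [::].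
have [s1 [w [-> hw]]] := word_split true u; have [s2 [v [ew hv]]] := word_split false w.
(* Without zeros the remainder can begin with neither bit, so it is empty; a word of ones has the
   empty code. *)
case: s2 ew => [|j s2] ew.
  have -> : w = [::] by case: v ew hv hw => [->//|[? c] v] -> /= ->.
  by exists [::] => // r Z; rewrite feasW_ones.
case: s1 => [|i s1]; first by rewrite ew.
rewrite {w hw}ew => le_k; set t := i :: s1 ++ j :: s2.
have eu : unzip1 ([seq (x, true) | x <- i :: s1] ++ [seq (x, false) | x <- j :: s2] ++ v)
          = t ++ unzip1 v.
  by rewrite /unzip1 !map_cat -!map_comp !map_id_in // catA.
rewrite {}eu cat_uniq => /and3P[ut tv uv] _.
have {}hv : head true (unzip2 v) by case: v hv {uv tv le_k} => [//|[? c] v] /= ->.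
have [|b vb fb] := IH v _ uv hv.
  by move: le_k; rewrite !size_cat !size_map /=; lia.
exists (([set x in t], size (i :: s1)) :: b).
  apply/and3P; split.
  - by apply/subsetP=> x; rewrite !in_set mem_cat => ->.
  - by rewrite cardsE (card_uniqP ut) /t /= size_cat /=; lia.
  - have -> // : [set x in t ++ unzip1 v] :\: [set x in t] = [set x in unzip1 v].
    apply/setP=> x; rewrite in_setD !in_set mem_cat.
    case xt: (x \in t) => //=; apply/esym/negP => xv.
    by move/hasP: tv; apply; exists x.
by move=> r Z; rewrite feasW_block -[_ ++ _]/t fb count_mem_set.
Qed.

(** Only the number of ones in a block matters, so they go to its first [a] letters. The letters of
    no block come last with bit 1, where they impose nothing. *)
Fixpoint word_of A b : seq (T * bool) :=
  if b is (G, a) :: b' then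
    [seq (i, true) | i <- take a (enum G)] ++
    [seq (i, false) | i <- drop a (enum G)] ++ word_of (A :\: G) b'
  else [seq (i, true) | i <- enum A].

Lemma word_of_letters A b : valid A b -> perm_eq (unzip1 (word_of A b)) (enum A).
Proof.
elim: b A => [|[G a] b IH] A /=.
  by move=> _; rewrite /unzip1 -map_comp map_id_in.
case/and3P=> sGA _ /IH IHb.
rewrite /unzip1 !map_cat -!map_comp !map_id_in // catA cat_take_drop.
apply: (@perm_trans _ (enum G ++ enum (A :\: G))); first by rewrite perm_cat2l.
apply: uniq_perm; rewrite ?enum_uniq // ?cat_uniq ?enum_uniq ?andbT /=.
  by apply/hasPn=> x; rewrite !mem_enum inE => /andP[].
move=> x; rewrite mem_cat !mem_enum inE; case xG: (x \in G) => //=.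
by rewrite (subsetP sGA).
Qed.

Lemma feasW_word_of A b r Z : valid A b -> feasW r (word_of A b) Z = feasB r b Z.
Proof.
elim: b A r => [|[G a] b IH] A r /=.
  by move=> _; rewrite -[map _ _]cats0 feasW_ones.
case/and3P=> _ /andP[_ aG] vb.
have sz : size (take a (enum G)) = a by rewrite size_takel // -cardE ltnW.
by rewrite feasW_block cat_take_drop sz IH // count_mem_set ?enum_uniq // set_enum.
Qed.

End Words.

(** * The Gale order through thresholds, the exchange axiom, and Schubert families as words *)

Section Schubert.

Variable n : nat.
Implicit Types (X Y Z S N : {set 'I_n}) (w : {perm signed n}).

Lemma elements_sorted Z : sorted ltn (elements Z).
Proof.
apply: (subseq_sorted ltn_trans (s2 := iota 0 n)); last exact: iota_ltn_sorted.
have -> : elements Z = [seq val i | i <- [seq i <- enum 'I_n | i \in Z]].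
  by rewrite /elements enumT.
by rewrite -val_enum_ord; apply/map_subseq/filter_subseq.
Qed.

(** In a decreasing list the entries at least [t] form an initial segment. *)
Lemma nth_decreasing (s : seq nat) t i : sorted (fun x y => y < x) s ->
  (i < count (leq t) s) = (i < size s) && (t <= nth 0 s i).
Proof.
elim: s i => [|x s IH] i //= ps.
have /allP min_s := order_path_min (fun a b c h1 h2 => ltn_trans h2 h1) ps.
have lt_nth j : j < size s -> nth 0 s j < x by move=> /(mem_nth 0)/min_s.
have [le_tx|lt_xt] := leqP t x.
  by case: i => [|i] /=; [rewrite le_tx | rewrite add1n !ltnS IH ?(path_sorted ps)].
have -> : count (leq t) s = 0.
  by apply/eqP; rewrite -leqn0 leqNgt -has_count; apply/hasPn=> y /min_s; lia.
rewrite ltn0; apply/esym/negP=> /andP[].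
by case: i => [|i] /=; [lia | rewrite ltnS => /lt_nth; lia].
Qed.

Definition count_above (t : nat) Z : nat := #|[set i in Z | t <= i]|.

(** Counting from 0, the [i]-th largest element is at least [t] exactly when more than [i] elements
    are. The Gale order thus becomes one inequality per threshold. *)
Lemma gale_leP Z S :
  reflect (forall t, count_above t Z <= count_above t S) (gale_le Z S).
Proof.
have size_e Y : size (rev (elements Y)) = #|Y| by rewrite size_rev size_map cardE.
have cnt t i Y : (i < count_above t Y) = (i < #|Y|) && (t <= nth 0 (elements Y) (#|Y| - i.+1)).
  have -> : count_above t Y = count (leq t) (rev (elements Y)).
    rewrite count_rev count_map -size_filter -(card_uniqP (filter_uniq _ (enum_uniq Y))).
    by apply: eq_card => j; rewrite !inE mem_filter mem_enum andbC.
  rewrite nth_decreasing ?size_e; last by rewrite rev_sorted elements_sorted.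
  by case: ltnP => // lt_i; rewrite nth_rev size_map -cardE.
apply: (iffP andP) => [[le_ZS /forallP le_nth] t|le_cnt].
  case e: (count_above t Z) => [//|i].
  have : i < count_above t Z by rewrite e.
  rewrite !cnt => /andP[lt_i le_t]; rewrite (leq_trans lt_i le_ZS) /=.
  exact: leq_trans le_t (le_nth (Ordinal lt_i)).
(* The threshold 0 recovers the comparison of cardinalities. *)
have cnt0 Y : count_above 0 Y = #|Y|.
  by apply: eq_card => j; rewrite !inE andbT.
split; first by rewrite -!cnt0.
apply/forallP=> i; set t := nth 0 _ _.
have : i < count_above t Z by rewrite cnt ltn_ord leqnn.
by move=> /leq_trans/(_ (le_cnt t)); rewrite cnt => /andP[].
Qed.

Lemma count_above1 t Z i : i \notin Z ->
  count_above t (i |: Z) = (t <= i) + count_above t Z.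
Proof.
move=> iZ; rewrite /count_above; case le_ti: (t <= i).
  have -> : [set j in i |: Z | t <= j] = i |: [set j in Z | t <= j].
    by apply/setP=> j; rewrite !inE; case: eqP => [->|].
  by rewrite cardsU1 inE (negPf iZ).
by apply: eq_card => j; rewrite !inE; case: eqP => [->|] //=; rewrite le_ti andbF.
Qed.

Lemma count_aboveS t Z Y : Z \subset Y -> count_above t Z <= count_above t Y.
Proof.
move=> /subsetP s; apply/subset_leq_card/subsetP=> i.
by rewrite !inE => /andP[/s-> ->].
Qed.

Lemma standard_schubert_delta S : delta_matroid (standard_schubert S).
Proof.
apply/andP; split.
  by apply/set0Pn; exists S; rewrite inE; apply/gale_leP.
apply/forall_inP=> X; rewrite inE => /gale_leP gX.
apply/forall_inP=> Y; rewrite inE => /gale_leP gY.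
apply/forall_inP=> e; rewrite in_symdiff => eXY.
(* As [[set e; e]] is [[set e]], the choice [f = e] toggles [e] alone; this suffices unless adding
   [e] violates a threshold. *)
have toggle : symdiff X [set e; e] \in standard_schubert S ->
    [exists f in symdiff X Y, symdiff X [set e; f] \in standard_schubert S].
  by move=> h; apply/exists_inP; exists e; rewrite ?in_symdiff.
have [eX|eX] := boolP (e \in X).
  apply: toggle; rewrite inE; apply/gale_leP=> t; apply: leq_trans (gX t).
  apply: count_aboveS; apply/subsetP=> i; rewrite in_symdiff !inE orbb.
  by case: eqP => [->|]; rewrite ?eX ?addbF.
have eY : e \in Y by move: eXY; rewrite (negPf eX).
have toggle_e : symdiff X [set e; e] = e |: X.
  apply/setP=> i; rewrite in_symdiff !inE orbb.
  by case: eqP => [->|]; rewrite ?(negPf eX) ?addbF.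
(* No element reaches [n], so thresholds in ['I_n] are enough, and among them a largest violated one
   can be chosen. *)
pose bad (t : 'I_n) := count_above t S < count_above t (e |: X).
have good (t : nat) : ~~ [exists t' : 'I_n, bad t' && (t == t' :> nat)] ->
    count_above t (e |: X) <= count_above t S.
  have [lt_tn|le_nt] := ltnP t n; last first.
    have -> : count_above t (e |: X) = count_above t X; last by move=> _; apply: gX.
    by rewrite count_above1 // (_ : t <= e = false) //; have := ltn_ord e; lia.
  move=> h; rewrite leqNgt; apply: contra h => b; apply/existsP; exists (Ordinal lt_tn).
  by rewrite /bad b /=.
have [t1 bad1|nbad] := pickP bad; last first.
  apply: toggle; rewrite inE toggle_e; apply/gale_leP=> t; apply: good.
  by apply/existsPn=> t'; rewrite nbad.
(* At the largest violated threshold [t0], removing from [X] any element above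
   [t0] repairs all the violated thresholds at once. *)
case: (arg_maxnP (fun t : 'I_n => t : nat) bad1) => t0 bad0 max0 {t1 bad1}.
(* [Y] obeys the threshold [t0], so the overfull part of [e |: X] above it is not inside [Y]; as [e]
   is in [Y], the witness comes from [X]. *)
have [f fXY le_f] : exists2 f, f \in X :\: Y & t0 <= f.
  have : ~~ ([set i in e |: X | t0 <= i] \subset Y).
    apply/negP=> sY; move: bad0; rewrite /bad ltnNge => /negP[].
    apply: leq_trans (gY t0); apply/subset_leq_card/subsetP=> i iX.
    by rewrite inE (subsetP sY) //; move: iX; rewrite inE => /andP[].
  case/subsetPn=> f; rewrite !inE => /andP[feX le_f] fY; exists f => //.
  by move: feX; rewrite !inE fY; case: eqP => // fe; rewrite fe eY in fY.
move: fXY; rewrite inE => /andP[fY fX'].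
apply/exists_inP; exists f; first by rewrite in_symdiff fX' (negPf fY).
have ef : e != f by apply: contraNneq eX => ->.
have -> : symdiff X [set e; f] = e |: (X :\ f).
  apply/setP=> i; rewrite in_symdiff !inE.
  case: eqP => [->|_]; first by rewrite (negPf eX).
  by case: eqP => [->|_] /=; rewrite ?fX' ?addbF.
have eXf : e \notin X :\ f by rewrite !inE (negPf eX) andbF.
rewrite inE; apply/gale_leP=> t.
have [le_t|lt_t] := leqP t t0.
  have := gX t; rewrite -{1}(setD1K fX') !count_above1 ?setD11 // (leq_trans le_t le_f).
  by case: (t <= e); lia.
apply: leq_trans (_ : count_above t (e |: X) <= _).
  by apply: count_aboveS; apply: setUS; apply: subD1set.
apply: good; apply/existsPn=> t'; apply/negP=> /andP[/max0 h /eqP et].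
by move: lt_t; rewrite et ltnNge => /negP[]; exact: h.
Qed.

(** The twist by [N] cancels in the symmetric difference of two members, so the exchange axiom is
    transported along the bijection [f]. *)
Lemma delta_matroid_relabel (f : 'I_n -> 'I_n) N (F : {set {set 'I_n}}) :
  injective f -> delta_matroid F ->
  delta_matroid [set X : {set 'I_n} | f @^-1: symdiff X N \in F].
Proof.
move=> inj_f /andP[/set0Pn[Z0 FZ0] exch].
have [g fK gK] := injF_bij inj_f.
have inE' X e : (e \in f @^-1: symdiff X N) = (f e \in X) (+) (f e \in N).
  by rewrite inE in_symdiff.
apply/andP; split.
  apply/set0Pn; exists (symdiff (g @^-1: Z0) N); rewrite inE symdiffK.
  by have -> // : f @^-1: (g @^-1: Z0) = Z0; apply/setP=> i; rewrite !inE fK.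
apply/forall_inP=> X FX; apply/forall_inP=> Y FY; apply/forall_inP=> e eXY.
rewrite !inE in FX FY.
have := forall_inP (forall_inP (forall_inP exch _ FX) _ FY) (g e).
rewrite in_symdiff !inE' gK addbACA addbb addbF -in_symdiff => /(_ eXY).
case/exists_inP=> i; rewrite in_symdiff !inE' addbACA addbb addbF -in_symdiff => iXY Fi.
apply/exists_inP; exists (f i) => //; rewrite inE.
have -> // : f @^-1: symdiff (symdiff X [set e; f i]) N = symdiff (f @^-1: symdiff X N) [set g e; i].
apply/setP=> j; rewrite inE' !in_symdiff inE' addbAC !inE (inj_eq inj_f).
by rewrite (can2_eq fK gK).
Qed.

Section Action.

Variable w : {perm signed n}.
Hypothesis sw : signed_perm w.

Definition perm_abs (i : 'I_n) : 'I_n := (w (pos i)).1.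

Lemma perm_abs_inj : injective perm_abs.
Proof.
move=> i j; rewrite /perm_abs => e.
have [e2|ne2] := eqVneq (w (pos i)).2 (w (pos j)).2.
  have : w (pos i) = w (pos j) by case: (w _) (w _) e e2 => [? ?] [? ?] /= -> ->.
  by move/perm_inj => [].
have : w (pos i) = neg (w (pos j)).
  by case: (w _) (w _) e ne2 => [? []] [? []] //= ->.
by rewrite -(eqP (forallP sw _)) => /perm_inj.
Qed.

Lemma perm_abs_negative i : (perm_abs i \in negative_values w) = (w (pos i)).2.
Proof.
apply/imsetP/idP => [[j]|wi]; last by exists i; rewrite ?inE.
by rewrite inE => wj /perm_abs_inj->.
Qed.

(** The combinatorial form of the transformed polytope: membership is complemented at negated
    letters, then letters are pulled back to positions. [schubert_polytope] justifies it. *)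
Definition schubert_family S : {set {set 'I_n}} :=
  [set X : {set 'I_n} | perm_abs @^-1: symdiff X (negative_values w) \in standard_schubert S].

Lemma schubert_family_delta S : delta_matroid (schubert_family S).
Proof. by apply: delta_matroid_relabel; [apply: perm_abs_inj | apply: standard_schubert_delta]. Qed.

End Action.

(** As long as the test passes, the slack after a prefix is [r] plus its ones minus its letters in
    [Z]; the recursion unfolds into one inequality per prefix. *)
Lemma feasWP (T : finType) r (u : seq (T * bool)) (Z : {set T}) :
  reflect (forall k, count (mem Z) (unzip1 (take k u)) <= r + count id (unzip2 (take k u)))
          (feasW r u Z).
Proof.
elim: u r => [|[i c] u IH] r /=; first by apply: ReflectT => -[].
apply: (iffP andP) => [[h1 /IH h2] [|k] //=|h].
  by have := h2 k; lia.
split; first by have := h 1; rewrite /= take0 /= !addn0.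
by apply/IH=> k; have := h k.+1; have := h 1; rewrite /= take0 /=; lia.
Qed.

Lemma count_drop_enum (p : pred 'I_n) m : count p (drop m (enum 'I_n)) = #|[set i | p i & m <= i]|.
Proof.
have in_t i : (i \in take m (enum 'I_n)) = (i < m).
  by rewrite in_take ?mem_enum // index_enum_ord.
have := enum_uniq 'I_n; rewrite -{1}(cat_take_drop m (enum 'I_n)) cat_uniq.
case/and3P=> _ /hasPn tv ud; rewrite -size_filter -(card_uniqP (filter_uniq _ ud)).
apply: eq_card => i; rewrite !inE mem_filter; congr (_ && _).
have := mem_enum 'I_n i; rewrite -{1}(cat_take_drop m (enum 'I_n)) mem_cat in_t.
case: (boolP (i \in drop m _)) => [/tv|_]; last by rewrite orbF inE ltnNge => /negbTE->.
by rewrite /= in_t -leqNgt => ->.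
Qed.

Definition schubert_word w S : seq ('I_n * bool) :=
  [seq (perm_abs w i, i \in S) | i <- rev (enum 'I_n)].

(** The first [k] letters of the word sit at the positions from [n - k] on, so prefix inequalities
    are the threshold inequalities of [gale_leP]. *)
Lemma feasW_schubert w S Z :
  signed_perm w -> feasW 0 (schubert_word w S) Z = (perm_abs w @^-1: Z \in standard_schubert S).
Proof.
move=> sw; rewrite inE.
have cntE (p : pred 'I_n) k : count p (take k (rev (enum 'I_n))) = #|[set i | p i & n - k <= i]|.
  by rewrite take_rev count_rev size_enum_ord count_drop_enum.
have c1 k : count (mem Z) (unzip1 (take k (schubert_word w S)))
    = count_above (n - k) (perm_abs w @^-1: Z).
  rewrite /unzip1 -map_take -map_comp count_map cntE.
  by apply: eq_card => i; rewrite !inE.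
have c2 k : count id (unzip2 (take k (schubert_word w S))) = count_above (n - k) S.
  by rewrite /unzip2 -map_take -map_comp count_map cntE.
apply/feasWP/gale_leP => h k; last by rewrite c1 c2; apply: h.
(* A threshold above [n] matches no prefix, but no position reaches it. *)
have [le_kn|lt_nk] := leqP k n; first by have := h (n - k); rewrite c1 c2 subKn.
rewrite /count_above eq_card0 // => i; rewrite !inE leqNgt (ltn_trans _ lt_nk) ?andbF //.
Qed.

Lemma schubert_familyE w S : signed_perm w ->
  schubert_family w S =
  [set X : {set 'I_n} | feasW 0 (schubert_word w S) (symdiff X (negative_values w))].
Proof. by move=> sw; apply/setP=> X; rewrite [LHS]inE [RHS]inE feasW_schubert. Qed.

End Schubert.

(** * Correspondence between Schubert families and code families *)

Section Characterization.

Variable n : nat.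
Implicit Types (S N : {set 'I_n}) (w : {perm signed n}) (b : seq ({set 'I_n} * nat)).

Lemma code_family_schubert N b : valid [set: 'I_n] b ->
  exists w S, signed_perm w /\ schubert_family w S = code_family N b.
Proof.
move=> vb; pose u := word_of [set: 'I_n] b.
have pu : perm_eq (unzip1 u) (enum 'I_n).
  by have := word_of_letters vb; rewrite (eq_enum (in_set _)).
(* Words list the largest position first, hence the reversal before indexing by positions. *)
have szu : size (rev u) == n.
  by rewrite size_rev -(size_map fst) (perm_size pu) size_enum_ord.
pose t := Tuple szu; pose f i := (tnth t i).1; pose S := [set i | (tnth t i).2].
have inj_f : injective f.
  have : uniq (map f (enum 'I_n)).
    rewrite /f (map_comp fst) map_tnth_enum /= map_rev rev_uniq.
    by rewrite (perm_uniq pu) enum_uniq.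
  by move=> uf; apply/injectiveP.
(* [N] supplies the sign of the image letter; adding [x.2] makes the map commute with [neg]. *)
pose g (x : signed n) : signed n := (f x.1, x.2 (+) (f x.1 \in N)).
have inj_g : injective g by case=> [i s] [j s'] [/inj_f<- /addIb<-].
pose w := perm inj_g; exists w, S.
have sw : signed_perm w.
  by apply/forallP=> x; rewrite !permE /g /neg /= addNb.
have wf : perm_abs w =1 f by move=> i; rewrite /perm_abs permE.
have neg_w : negative_values w = N.
  have [h fK hK] := injF_bij inj_f; apply/setP=> j; rewrite -(hK j) -wf.
  by rewrite perm_abs_negative // permE /= wf.
split=> //; rewrite schubert_familyE // neg_w; apply/setP=> X; rewrite !inE.
rewrite -(feasW_word_of _ _ vb); congr (feasW _ _ _).
rewrite /schubert_word map_rev; apply: (can_inj revK); rewrite revK.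
transitivity (val t); last by [].
rewrite -[RHS]map_tnth_enum; apply: eq_map => i; rewrite wf /f inE.
by case: (tnth t i).
Qed.

Lemma schubert_family_code w S : signed_perm w ->
  loopless (schubert_family w S) -> coloopless (schubert_family w S) ->
  exists N b, [/\ valid [set: 'I_n] b, N \subset supp b & schubert_family w S = code_family N b].
Proof.
move=> sw ll cl; rewrite schubert_familyE // in ll cl *.
set u := schubert_word w S in ll cl *; set N := negative_values w in ll cl *.
have eu1 : unzip1 u = map (perm_abs w) (rev (enum 'I_n)) by rewrite /unzip1 -map_comp.
have uu : uniq (unzip1 u).
  by rewrite eu1 map_inj_uniq ?rev_uniq ?enum_uniq //; apply: perm_abs_inj.
(* A leading bit 0 would freeze the membership of the top letter: a coloop if it is negated, a loop
   otherwise. *)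
have hu : head true (unzip2 u).
  case eu: u => [//|[i [|]] v] //=; exfalso.
  have fixed X : feasW 0 u (symdiff X N) -> (i \in X) = (i \in N).
    by rewrite eu /= leqn0 eqb0 in_symdiff => /andP[h _]; case: (i \in X) h; case: (i \in N).
  have [iN|iN] := boolP (i \in N).
    move/forallP/(_ i)/negP: cl; apply; apply/forall_inP=> X; rewrite inE => /fixed->.
    exact: iN.
  move/forallP/(_ i)/exists_inP: ll => [X]; rewrite inE => /fixed->; exact/negP.
have [b vb fb] := word_code uu hu; exists (N :&: supp b), b; split.
- have <- // : [set x in unzip1 u] = [set: 'I_n].
  apply/setP=> j; rewrite !inE eu1.
  have [h fK hK] := injF_bij (perm_abs_inj sw).
  by rewrite -(hK j) mem_map ?mem_rev ?mem_enum //; apply: perm_abs_inj.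
- exact: subsetIr.
- by rewrite code_family_supp; apply/setP=> X; rewrite !inE fb.
Qed.

End Characterization.

(** * Enumeration of codes and the sum of their weights over subsets *)

Section CodeLists.

Variable T : finType.
Implicit Types (A B G : {set T}) (b : seq ({set T} * nat)).

Definition blocks A : seq ({set T} * nat) :=
  [seq (G, a) | G <- enum (powerset A), a <- iota 1 #|G|.-1].

(** [k] is fuel for the recursion; [#|A|] is enough because blocks of a valid code are nonempty. *)
Fixpoint codes (k : nat) A : seq (seq ({set T} * nat)) :=
  if k is k'.+1 then [::] :: [seq p :: b | p <- blocks A, b <- codes k' (A :\: p.1)]
  else [:: [::]].

Lemma mem_blocks A G a : ((G, a) \in blocks A) = (G \subset A) && (0 < a < #|G|).
Proof.
apply/allpairsPdep/idP => [[G' [a' [hG ha [-> ->]]]]|/andP[sGA h]].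
  by move: hG ha; rewrite mem_enum powersetE mem_iota => -> /=; lia.
by exists G, a; split; rewrite ?mem_enum ?powersetE ?mem_iota //; lia.
Qed.

Lemma mem_codes k A b : #|A| <= k -> (b \in codes k A) = valid A b.
Proof.
elim: k A b => [|k IH] A [|[G a] b] //= le_k.
  rewrite inE; apply/esym/negP=> /and3P[/subset_leq_card h1 /andP[h2 h3] _]; lia.
rewrite inE /= andbA -mem_blocks; apply/allpairsPdep/andP => [[p [b' [hp hb [ep eb]]]]|[hp vb]].
  rewrite -{p}ep in hp hb; rewrite -{b'}eb in hb; split=> //; rewrite -IH //=.
  by move: hp; rewrite mem_blocks => /andP[sGA]; rewrite cardsD (setIidPr sGA); lia.
exists (G, a), b; split=> //=; rewrite IH //.
by move: hp; rewrite mem_blocks => /andP[sGA]; rewrite cardsD (setIidPr sGA); lia.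
Qed.

Lemma codes_uniq k A : uniq (codes k A).
Proof.
elim: k A => [|k IH] A //=; apply/andP; split.
  by apply/negP=> /allpairsPdep[p [b []]].
apply: allpairs_uniq_dep => // [|[? ?] [? ?] _ _ /= [-> ->] //].
apply: allpairs_uniq_dep => [|G _|[? ?] [? ?] _ _ /= [-> ->] //].
  exact: enum_uniq.
exact: iota_uniq.
Qed.

(** This counts the listed codes together with a set of negated letters inside the support. *)
Definition weight k A : nat := \sum_(b <- codes k A) 2 ^ #|supp b|.

(** The empty code gives the 1. Otherwise a top block [G] leaves [#|G|.-1] values of [a], [2 ^ #|G|]
    sign choices and a code on [A :\: G]. *)
Lemma weightS k A : #|A| <= k.+1 ->
  weight k.+1 A = 1 + \sum_(G in powerset A) #|G|.-1 * 2 ^ #|G| * weight k (A :\: G).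
Proof.
move=> le_k; rewrite /weight big_cons /= cards0; congr (_ + _).
rewrite big_allpairs_dep /= big_allpairs_dep /= big_enum /=.
apply: eq_bigr => G; rewrite powersetE => sGA.
rewrite (eq_big_seq (fun=> 2 ^ #|G| * weight k (A :\: G))) => [|a].
  by rewrite big_const_seq count_predT size_iota iter_addn_0 mulnC mulnA.
rewrite mem_iota => ha; rewrite /weight big_distrr /=; apply: eq_big_seq => b.
have le_AG : #|A :\: G| <= k by rewrite cardsD (setIidPr sGA); lia.
rewrite mem_codes // => /valid_disjoint; rewrite -setI_eq0 => /eqP dGb.
by rewrite cardsU dGb cards0 subn0 expnD.
Qed.

Lemma sum_powerset_card A (f : nat -> nat) :
  \sum_(G in powerset A) f #|G| = \sum_(k < #|A|.+1) 'C(#|A|, k) * f k.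
Proof.
rewrite (partition_big (fun G : {set T} => inord #|G| : 'I_#|A|.+1) predT) //=.
apply: eq_bigr => k _; rewrite -cards_draws -sum_nat_const.
have inordE G : G \subset A -> (inord #|G| == k) = (#|G| == k).
  by move=> /subset_leq_card le; rewrite -val_eqE /= inordK.
apply: eq_big => G; last by case/andP; rewrite powersetE => sG; rewrite inordE // => /eqP->.
by rewrite powersetE inE; case: (boolP (G \subset A)) => //= /inordE.
Qed.

Lemma sum_hooks n : 1 + \sum_(k < n.+1) 'C(n, k) * (k.-1 * (n - k)`!) = n`!.
Proof.
have part m : m <= n ->
    n ^_ (n - m) + \sum_(k < m.+1) 'C(n, k) * (k.-1 * (n - k)`!) = n`!.
  elim: m => [|m IH] lt_m; first by rewrite big_ord1 /= mul0n muln0 addn0 subn0 ffactnn.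
  rewrite big_ord_recr /= -(IH (ltnW lt_m)).
  have -> : n - m = (n - m.+1).+1 by lia.
  have := bin_ffact n (n - m.+1); rewrite bin_sub // => e.
  by rewrite ffactnSr subKn // mulnCA e mulnS (mulnC m) -addnA; congr (_ + _); apply: addnC.
by rewrite -(part n) // subnn ffactn0.
Qed.

Lemma sum_sub_exchange A (c W : {set T} -> nat) :
  \sum_(B in powerset A) \sum_(G in powerset B) c G * W (B :\: G) =
  \sum_(G in powerset A) c G * \sum_(B in powerset (A :\: G)) W B.
Proof.
rewrite (exchange_big_dep (mem (powerset A))) /=; last first.
  by move=> B G; rewrite !powersetE => sB sG; apply: subset_trans sB.
apply: eq_bigr => G; rewrite powersetE => sGA; rewrite -big_distrr; congr (_ * _).
(* A subset of [A] containing [G] is determined by its part outside [G], an arbitrary subset of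
   [A :\: G]. *)
rewrite (reindex_onto (fun B => B :|: G) (fun B => B :\: G)) /=; last first.
  by move=> B /andP[_]; rewrite powersetE => sGB; rewrite setUC -{2}(setID B G) (setIidPr sGB).
apply: eq_big => B; last by move=> /andP[_ /eqP->].
rewrite !powersetE subUset sGA subsetUr !andbT subsetD setDUl setDv setU0; congr (_ && _).
by apply/eqP/idP => [/setDidPl|/setDidPl].
Qed.

(** Summing [weightS] over subsets and exchanging the sums leaves a full subset sum over [A :\: G],
    known by induction; the factorials then add up by [sum_hooks]. *)
Lemma sum_weight k A : #|A| <= k ->
  \sum_(B in powerset A) weight k B = 2 ^ #|A| * #|A|`!.
Proof.
elim: k A => [|k IH] A le_k.
  move: le_k; rewrite leqn0 cards_eq0 => /eqP->.
  by rewrite powerset0 big_set1 /weight /= big_seq1 cards0.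
have le_B B : B \in powerset A -> #|B| <= k.+1.
  by rewrite powersetE => /subset_leq_card le_B; apply: leq_trans le_B le_k.
rewrite (eq_bigr _ (fun B hB => weightS (le_B B hB))) big_split /= sum1_card card_powerset.
rewrite (sum_sub_exchange A (fun G => #|G|.-1 * 2 ^ #|G|)) -[in RHS]sum_hooks mulnDr muln1.
congr (_ + _); rewrite -(sum_powerset_card A (fun m => m.-1 * (#|A| - m)`!)) big_distrr /=.
apply: eq_bigr => G; rewrite powersetE => sGA.
have cG := subset_leq_card sGA; have cD : #|A :\: G| = #|A| - #|G| by rewrite cardsD (setIidPr sGA).
(* The empty [G] leaves [A] unchanged, out of reach of the induction, but its coefficient is
   zero. *)
have [->|G0] := eqVneq G set0; first by rewrite cards0 !mul0n muln0.
rewrite -card_gt0 in G0; rewrite IH ?cD; last by lia.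
have -> : 2 ^ #|A| = 2 ^ #|G| * 2 ^ (#|A| - #|G|) by rewrite -expnD subnKC.
by rewrite (mulnC #|G|.-1) mulnACA.
Qed.

End CodeLists.

(** * Signed permutations counted by the set of letters they move *)

Section SignedPermutations.

Variable n : nat.
Implicit Types (A B : {set 'I_n}) (w : {perm signed n}).

Definition moved w : {set 'I_n} := [set i | w (pos i) != pos i].

Definition signed_perms_on A : {set {perm signed n}} :=
  [set w | signed_perm w && (moved w \subset A)].

Lemma signed_permE w x : signed_perm w -> w (neg x) = neg (w x).
Proof. by move=> /forallP/(_ x)/eqP. Qed.

Lemma signed_perms_on_fix A w x : w \in signed_perms_on A -> x.1 \notin A -> w x = x.
Proof.
rewrite inE => /andP[sw /subsetP mw]; case: x => i s /= iA.
have wi : w (pos i) = pos i by apply/eqP; apply: contraNT iA => h; apply: mw; rewrite inE.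
by case: s => //; rewrite -[(i, true)]/(neg (pos i)) signed_permE // wi.
Qed.

Lemma signed_perms_on_group A : group_set (signed_perms_on A).
Proof.
apply/group_setP; split=> [|u v].
  rewrite inE; apply/andP; split; first by apply/forallP=> x; rewrite !perm1.
  by apply/subsetP=> i; rewrite inE perm1 eqxx.
move=> hu hv; have := hu; have := hv; rewrite !inE => /andP[sv _] /andP[su _].
apply/andP; split; first by apply/forallP=> x; rewrite !permM !signed_permE.
apply/subsetP=> i; rewrite inE permM; apply: contraR => iA.
by rewrite (signed_perms_on_fix hu) ?(signed_perms_on_fix hv).
Qed.
Canonical signed_perms_on_gp A := Group (signed_perms_on_group A).

Lemma signed_perms_on_orbit A i : i \in A ->
  orbit 'P (signed_perms_on A) (pos i) = [set x : signed n | x.1 \in A].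
Proof.
move=> iA; apply/setP=> -[j s]; rewrite [RHS]inE /=; apply/orbitP/idP.
  case=> w hw /= ewi; apply/negPn/negP=> jA.
  have : w (j, s) = w (pos i) by rewrite (signed_perms_on_fix hw).
  by move/perm_inj=> [ji _]; rewrite ji iA in jA.
(* The signed transposition exchanging [i] with [j] up to the sign [s]; for [j = i] it is the
   identity or the negation of [i]. *)
move=> jA; pose g (y : signed n) : signed n :=
  if y.1 == i then (j, s (+) y.2) else if y.1 == j then (i, s (+) y.2) else y.
have gK : involutive g.
  case=> k t; rewrite /g /=; have [->|ki] := eqVneq k i.
    by rewrite /=; case: eqVneq => [->|_]; rewrite ?eqxx /= addKb.
  by have [->|kj] := eqVneq k j; rewrite /= ?eqxx ?addKb // (negPf ki) (negPf kj).
exists (perm (inv_inj gK)); last by rewrite /= apermE permE /g /= eqxx addbF.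
rewrite inE; apply/andP; split.
  apply/forallP=> -[k t]; rewrite !permE /g /neg /=.
  by do 2?case: ifP => _ //=; rewrite addbN.
apply/subsetP=> k; rewrite inE permE /g /=; have [->//|_] := eqVneq k i.
by have [->//|_] := eqVneq k j; rewrite eqxx.
Qed.

(** Orbit-stabilizer at a letter [i] of [A]: the orbit has [#|A| * 2] elements, and the stabilizer
    is the same group for [A :\ i]. *)
Lemma card_signed_perms_on A : #|signed_perms_on A| = 2 ^ #|A| * #|A|`!.
Proof.
move: {2}#|A| (leqnn #|A|) => k; elim: k A => [|k IH] A.
  rewrite leqn0 cards_eq0 => /eqP->; rewrite cards0 expn0 fact0 muln1.
  suff -> : signed_perms_on set0 = [set 1%g] by rewrite cards1.
  apply/setP=> w; rewrite in_set1; apply/idP/eqP => [hw|->]; last exact: (group1 (signed_perms_on_gp _)).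
  by apply/permP=> x; rewrite perm1 (signed_perms_on_fix hw) ?in_set0.
have [->|[i iA]] := set_0Vmem A; first by move=> _; apply: IH; rewrite cards0.
have cA := cardsD1 i A; rewrite iA in cA => le_k.
rewrite -(card_orbit_stab 'P (signed_perms_on_gp A) (pos i)) signed_perms_on_orbit //.
have -> : #|[set x : signed n | x.1 \in A]| = #|A| * 2.
  by rewrite -card_bool -cardsT -cardsX; apply: eq_card => -[j s]; rewrite !inE andbT.
have -> : ('C_(signed_perms_on_gp A)[pos i | 'P])%g = signed_perms_on (A :\ i).
  apply/setP=> w; rewrite !inE sub1set inE /= apermE -andbA; congr (_ && _).
  rewrite subsetD1 inE negbK; congr (_ && _).
rewrite IH; last by lia.
by rewrite cA add1n factS expnS; lia.
Qed.

Definition perms_moving A : {set {perm signed n}} := [set w | signed_perm w && (moved w == A)].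

Lemma sum_perms_moving A :
  \sum_(B in powerset A) #|perms_moving B| = 2 ^ #|A| * #|A|`!.
Proof.
rewrite -card_signed_perms_on -sum1_card (partition_big moved (fun B : {set 'I_n} => B \in powerset A)) /=.
  apply: eq_bigr => B; rewrite powersetE => sBA; rewrite -sum1_card; apply: eq_bigl => w.
  by rewrite !inE -andbA; congr (_ && _); case: eqP => [->|_]; rewrite ?sBA ?andbF.
by move=> w; rewrite powersetE inE => /andP[].
Qed.

(** Both sides have the same sums over all powersets, and such sums determine a function of subsets
    by induction on the cardinality. *)
Lemma card_perms_moving A : #|perms_moving A| = weight n A.
Proof.
have [k] := ubnP #|A|; elim: k A => // k IH A /ltnSE le_k.
have AA : A \in powerset A by rewrite powersetE.
have := sum_perms_moving A; rewrite -(@sum_weight _ n); last first.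
  by rewrite -[n in _ <= n]card_ord max_card.
rewrite (bigD1 A AA) [in RHS](bigD1 A AA) /=.
have -> : \sum_(B in powerset A | B != A) #|perms_moving B|
        = \sum_(B in powerset A | B != A) weight n B; last by move/addIn.
apply: eq_bigr => B /andP[]; rewrite powersetE => sBA ne; apply: IH.
by apply: leq_trans le_k; apply: proper_card; rewrite properEneq ne.
Qed.

Lemma signed_derangements_moving : [set w | signed_derangement w] = perms_moving [set: 'I_n].
Proof.
apply/setP=> w; rewrite !inE /signed_derangement; case sw: (signed_perm w) => //=.
apply/forallP/eqP => [h|/setP h [i s]].
  by apply/setP=> i; rewrite !inE h.
have := h i; rewrite !inE; case: s => //; apply: contraNneq.
by rewrite -[(i, true)]/(neg (pos i)) signed_permE //; case: (w _) => j [] [->].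
Qed.

End SignedPermutations.

From mathcomp Require Import boolp classical_sets reals convex interval_inference ring lra.
Import Order.TTheory GRing.Theory Num.Theory.

(** * Feasible polytopes and the affine action of signed permutations *)

Section Polytopes.

Variables (R : realType) (n : nat).
Implicit Types (A B X S : {set 'I_n}) (F : {set {set 'I_n}}).

Local Open Scope ring_scope.
Local Open Scope classical_set_scope.

Lemma indicator_vecE A i : indicator_vec R A 0 i = (i \in A)%:R.
Proof.
rewrite /indicator_vec summxE; have [iA|iA] := boolP (i \in A).
  rewrite (bigD1 i iA) /= mxE !eqxx big1 ?addr0 // => j /andP[_ ji].
  by rewrite mxE eqxx eq_sym (negPf ji).
by rewrite big1 // => j jA; rewrite mxE eqxx; case: eqP iA => // ->; rewrite jA.
Qed.

Lemma convex_setP (C : set 'rV[R]_n) : @convex_set R 'rV[R]_n C <->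
  forall x y t, 0 <= t <= 1 -> C x -> C y -> C (t *: x + (1 - t) *: y).
Proof.
split=> h x y t; last by rewrite !inE; apply: h; apply/andP.
by case/andP=> t0 t1 Cx Cy; apply/set_mem/(h x y (Itv01 t0 t1)); apply/mem_set.
Qed.

Lemma convex_hull_min (C Y : set 'rV[R]_n) :
  (forall x y t, 0 <= t <= 1 -> C x -> C y -> C (t *: x + (1 - t) *: y)) ->
  Y `<=` C -> convex_hull Y `<=` C.
Proof. by move=> hC; apply: smallest_sub; apply/convex_setP. Qed.

Lemma convex_hull_comb (Y : set 'rV[R]_n) x y t : 0 <= t <= 1 ->
  convex_hull Y x -> convex_hull Y y -> convex_hull Y (t *: x + (1 - t) *: y).
Proof.
move=> t01 hx hy C hC; have [/convex_setP convC _] := hC.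
by apply: convC; [| exact: hx | exact: hy].
Qed.

Lemma feasible_polytope_vertex F A : A \in F -> feasible_polytope R F (indicator_vec R A).
Proof. by move=> FA; apply: sub_gen_smallest; exists A. Qed.

(* If [A] is infeasible, every feasible vertex lies at [l^1]-distance at least 1
   from the vertex [A], which is a linear condition on the cube. *)
Lemma feasible_polytope_sub F F' :
  feasible_polytope R F `<=` feasible_polytope R F' -> F \subset F'.
Proof.
move=> sFF'; apply/fintype.subsetP=> A FA; apply/negPn/negP=> nFA.
pose dist (v : 'rV[R]_n) := \sum_i (if i \in A then 1 - v 0 i else v 0 i).
have distD x y t : dist (t *: x + (1 - t) *: y) = t * dist x + (1 - t) * dist y.
  rewrite /dist !big_distrr -big_split /=; apply: eq_bigr => i _.
  by rewrite !mxE; case: ifP => _; ring.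
have : feasible_polytope R F' `<=` [set v | 1 <= dist v].
  apply: convex_hull_min => [x y t /andP[t0 t1] /= hx hy|_ [B FB <-] /=].
    by rewrite distD; nra.
  have [i iAB] : exists i, (i \in A) != (i \in B).
    case: (pickP (fun i => (i \in A) != (i \in B))) => [i|eAB]; first by exists i.
    by case/negP: nFA; have -> // : A = B; apply/setP=> i; apply/eqP/negbFE/eAB.
  rewrite /dist (bigD1 i) //= indicator_vecE -[leLHS]addr0; apply: lerD.
    by case: (i \in A) iAB; case: (i \in B) => //= _; rewrite ?subr0.
  apply: sumr_ge0 => j _; rewrite indicator_vecE.
  by case: (j \in A); case: (j \in B); rewrite ?subrr ?subr0.
move/(_ _ (sFF' _ (feasible_polytope_vertex FA))) => /=.
rewrite /dist big1 ?ler10 // => i _; rewrite indicator_vecE.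
by case: (i \in A); rewrite ?subrr.
Qed.

Lemma feasible_polytope_inj : injective (@feasible_polytope R n).
Proof.
by move=> F F' e; apply/eqP; rewrite finset.eqEsubset !feasible_polytope_sub // e.
Qed.

Section Action.

Variable w : {perm signed n}.
Hypothesis sw : signed_perm w.

Lemma signed_perm_actD (x y : 'rV[R]_n) (s t : R) :
  signed_perm_act w (s *: x + t *: y) = s *: signed_perm_act w x + t *: signed_perm_act w y.
Proof.
rewrite /signed_perm_act !scaler_sumr -big_split; apply: eq_bigr => i _ /=.
by rewrite !mxE scalerDl !scalerA.
Qed.

Lemma signed_perm_actE (v : 'rV[R]_n) i :
  signed_perm_act w v 0 (perm_abs w i) = (-1) ^+ (w (pos i)).2 * v 0 i.
Proof.
rewrite /signed_perm_act summxE (bigD1 i) //= big1 ?addr0 => [|j ji]; rewrite !mxE /=.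
  by rewrite /perm_abs !eqxx mulr1 mulrC.
rewrite -[(w (pos j)).1]/(perm_abs w j).
by rewrite (inj_eq (perm_abs_inj sw)) [i == j]eq_sym (negPf ji) ?andbF /= !mulr0.
Qed.

(** At a negated coordinate the sign change followed by the translation turns [x] into [1 - x],
    which complements membership. *)
Lemma indicator_vec_act X :
  signed_perm_act w (indicator_vec R (perm_abs w @^-1: symdiff X (negative_values w)))
    + indicator_vec R (negative_values w) = indicator_vec R X.
Proof.
have [h hK fK] := injF_bij (perm_abs_inj sw); apply/rowP=> j; rewrite -(fK j).
rewrite mxE signed_perm_actE !indicator_vecE inE in_symdiff perm_abs_negative //.
by case: (_ \in X); case: (w _).2; rewrite /= ?expr0 ?expr1 ?mul1r ?mulN1r ?addr0 ?add0r ?addNr ?oppr0 ?add0r.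
Qed.

(** An affine map commutes with convex hulls, and by [indicator_vec_act] this one matches the
    vertices. *)
Lemma schubert_polytope S :
  feasible_polytope R (schubert_family w S) =
  [set signed_perm_act w v + indicator_vec R (negative_values w)
    | v in feasible_polytope R (standard_schubert S)]%classic.
Proof.
have affine x y t : signed_perm_act w (t *: x + (1 - t) *: y) + indicator_vec R (negative_values w)
   = t *: (signed_perm_act w x + indicator_vec R (negative_values w))
     + (1 - t) *: (signed_perm_act w y + indicator_vec R (negative_values w)).
  by rewrite signed_perm_actD !scalerDr addrACA -scalerDl [t + _]addrC subrK scale1r.
apply/seteqP; split=> [|_ [v hv <-]].
  apply: convex_hull_min => [_ _ t t01 [x hx <-] [y hy <-]|_ [X FX <-]].
    by rewrite -affine; exists (t *: x + (1 - t) *: y) => //; apply: convex_hull_comb.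
  exists (indicator_vec R (perm_abs w @^-1: symdiff X (negative_values w))).
    by apply: feasible_polytope_vertex; move: FX; rewrite /= inE.
  exact: indicator_vec_act.
(* The preimage of a hull under the affine map is convex, so it is enough that it contains the
   standard vertices. *)
pose C := [set v | feasible_polytope R (schubert_family w S)
                     (signed_perm_act w v + indicator_vec R (negative_values w))]%classic.
suff : feasible_polytope R (standard_schubert S) `<=` C by apply.
apply: convex_hull_min => [x y t t01 hx hy|_ [Z SZ <-]].
  by rewrite /C /= affine; apply: convex_hull_comb.
have [h hK fK] := injF_bij (perm_abs_inj sw).
pose X := symdiff (h @^-1: Z) (negative_values w).
have eZ : Z = perm_abs w @^-1: symdiff X (negative_values w).
  by apply/setP=> i; rewrite inE symdiffK inE hK.
rewrite /C /= {1}eZ indicator_vec_act; apply: feasible_polytope_vertex.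
by rewrite inE -eZ.
Qed.

End Action.

(** A family is determined by its polytope, so the geometric definition reduces to the combinatorial
    one. *)
Lemma is_schubertP F : is_schubert R F <->
  exists w S, signed_perm w /\ F = schubert_family w S.
Proof.
split=> [[w [S [sw [_ eF]]]]|[w [S [sw ->]]]]; exists w, S; split=> //.
  by apply: feasible_polytope_inj; rewrite eF schubert_polytope.
by split; [apply: schubert_family_delta | apply: schubert_polytope].
Qed.

End Polytopes.

Theorem corollary1p11 (R : realType) (n : nat) (hn : (0 < n)%N) :
  #|[set F : {set {set 'I_n}} |
      [&& loopless F, coloopless F & `[< is_schubert R F >]]]%SET|
  = #|[set w : {perm signed n} | signed_derangement w]%SET|.
Proof.
rewrite signed_derangements_moving card_perms_moving.
have le_n : #|[set: 'I_n]| <= n by rewrite cardsT card_ord.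
(* [L] lists the normal forms, with signs only inside the support; by [code_family_inj] each family
   arises from exactly one of them. *)
pose L := [seq (N, b) | b <- codes n [set: 'I_n], N <- enum (powerset (supp b))].
have memL N b : ((N, b) \in L) = valid [set: 'I_n] b && (N \subset supp b).
  apply/allpairsPdep/andP => [[b' [N' [hb hN [-> ->]]]]|[vb sN]].
    by move: hb hN; rewrite mem_codes // mem_enum powersetE.
  by exists b, N; rewrite mem_codes // mem_enum powersetE.
have uL : uniq [seq code_family c.1 c.2 | c <- L].
  rewrite map_inj_in_uniq; last first.
    move=> [N1 b1] [N2 b2]; rewrite !memL => /andP[v1 s1] /andP[v2 s2] /=.
    exact: code_family_inj v1 v2 s1 s2.
  apply: allpairs_uniq_dep; [exact: codes_uniq | by move=> b _; exact: enum_uniq |].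
  by move=> [? ?] [? ?] _ _ /= [-> ->].
have -> : weight n [set: 'I_n] = size [seq code_family c.1 c.2 | c <- L].
  rewrite size_map size_allpairs_dep sumnE big_map; apply: eq_bigr => b _.
  by rewrite -cardE card_powerset.
rewrite -(card_uniqP uL); apply: eq_card => F; rewrite inE.
apply/and3P/mapP => [[ll cl /asboolP/is_schubertP[w [S [sw eF]]]]|[[N b]]].
  rewrite eF in ll cl *.
  have [N [b [vb sN eNb]]] := schubert_family_code sw ll cl.
  by exists (N, b); rewrite ?memL ?vb.
rewrite memL => /andP[vb _] /= ->; split.
- exact: code_family_loopless vb.
- exact: code_family_coloopless vb.
- apply/asboolP/is_schubertP; have [w [S [sw <-]]] := code_family_schubert N vb.
  by exists w, S.
Qed.
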